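(* Let $n\ge3$ and $k>1$. Every complex homogeneous $2$-local representation $\beta:M_kVB_n\to\mathrm{GL}_n(\mathbb{C})$ is unfaithful (i.e. not injective), except possibly those of the following three types (which may or may not be faithful): $$\beta(\sigma_i)=E_i(S),\qquad \beta(\rho_i^\alpha)=E_i\begin{pmatrix}0&x_\alpha\\ \frac1{x_\alpha}&0\end{pmatrix}\qquad(1\le i\le n-1,\ 0\le\alpha\le k-1),$$ where each $x_\alpha\in\mathbb{C}$ is nonzero and $S$ is one of $$\begin{pmatrix}1-bc&b\\c&0\end{pmatrix}\ (bc\ne0),\qquad \begin{pmatrix}0&b\\c&0\end{pmatrix}\ (bc\neq0),\qquad \begin{pmatrix}0&-\frac{d-1}{c}\\c&d\end{pmatrix}\ (c\neq0,\ d\ne1),$$ with $b,c,d\in\mathbb{C}$.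
   Context: For $n\ge2$, $k>1$, the multi-virtual braid group $M_kVB_n$ is the group generated by $\sigma_1,\dots,\sigma_{n-1}$ and $\rho_1^{\alpha},\dots,\rho_{n-1}^{\alpha}$ for $\alpha=0,1,\dots,k-1$ (here $\alpha$ is a superscript index, not a power), subject to the relations: - $\sigma_i\sigma_{i+1}\sigma_i=\sigma_{i+1}\sigma_i\sigma_{i+1}$ for $1\le i\le n-2$; - $\sigma_i\sigma_j=\sigma_j\sigma_i$ for $|i-j|\ge2$; - $(\rho_i^\alpha)^2=e$ for $1\le i\le n-1$ and all $\alpha$; - $\rho_i^\alpha\rho_j^\alpha=\rho_j^\alpha\rho_i^\alpha$ for $|i-j|\ge2$ and all $\alpha$; - $\rho_i^\alpha\rho_{i+1}^\alpha\rho_i^\alpha=\rho_{i+1}^\alpha\rho_i^\alpha\rho_{i+1}^\alpha$ for $1\le i\le n-2$ and all $\alpha$; - $\sigma_i\rho_j^\alpha=\rho_j^\alpha\sigma_i$ for $|i-j|\ge2$ and all $\alpha$; - $\rho_i^\alpha\rho_j^\beta=\rho_j^\beta\rho_i^\alpha$ for $|i-j|\ge2$ and $\alpha\ne\beta$; - $\sigma_i\rho_{i+1}^0\rho_i^0=\rho_{i+1}^0\rho_i^0\sigma_{i+1}$ for $1\le i\le n-2$; - $\rho_i^0\rho_{i+1}^0\rho_i^\beta=\rho_{i+1}^\beta\rho_i^0\rho_{i+1}^0$ for $1\le i\le n-2$ and $1\le\beta\le k-1$. For a $2\times2$ matrix $M$ and $1\le i\le n-1$, $E_i(M)$ denotes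 the $n\times n$ block diagonal matrix $\mathrm{diag}(I_{i-1},M,I_{n-i-1})$, where $I_r$ is the $r\times r$ identity matrix. A complex homogeneous $2$-local representation of $M_kVB_n$ is a group homomorphism $\beta:M_kVB_n\to\mathrm{GL}_n(\mathbb{C})$ for which there are matrices $S,X_0,\dots,X_{k-1}\in\mathrm{GL}_2(\mathbb{C})$ with $\beta(\sigma_i)=E_i(S)$ and $\beta(\rho_i^\alpha)=E_i(X_\alpha)$ for all $1\le i\le n-1$ and $0\le\alpha\le k-1$. *)

(* Defs.v *)
From HB Require Import structures.
From mathcomp Require Import all_boot all_order all_algebra.
From mathcomp Require Import boolp complex reals.
Set Implicit Arguments.
Unset Strict Implicit.
Unset Printing Implicit Defensive.
Import GRing.Theory.
Local Open Scope group_scope.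
Local Open Scope quotient_scope.

Section Presentation.
Variable X : choiceType.

(* A letter (x, false) stands for the generator x, and (x, true) for x^-1. *)
Definition word := seq (X * bool).

Definition invw (u : word) : word := rev [seq (l.1, ~~ l.2) | l <- u].

Definition letter (x : X) : word := [:: (x, false)].

Variable R : word -> word -> Prop.

(* The congruence on words whose classes are the elements of < X | u = v for
   R u v >: the least one containing R and the free cancellations. *)
Inductive pres_eq : word -> word -> Prop :=
| pres_refl u : pres_eq u u
| pres_sym u v : pres_eq u v -> pres_eq v u
| pres_trans u v w : pres_eq u v -> pres_eq v w -> pres_eq u w
| pres_cat u1 u2 v1 v2 :
    pres_eq u1 u2 -> pres_eq v1 v2 -> pres_eq (u1 ++ v1) (u2 ++ v2)
| pres_cancel x b : pres_eq [:: (x, b); (x, ~~ b)] [::]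
| pres_rel u v : R u v -> pres_eq u v.

Definition pres_eqb : rel word := fun u v => `[< pres_eq u v >].

Lemma pres_eqb_refl : reflexive pres_eqb.
Proof. by move=> u; apply/asboolP/pres_refl. Qed.

Lemma pres_eqb_sym : symmetric pres_eqb.
Proof. by move=> u v; apply/asboolP/asboolP; apply: pres_sym. Qed.

Lemma pres_eqb_trans : transitive pres_eqb.
Proof.
by move=> v u w /asboolP uv /asboolP vw; apply/asboolP/(pres_trans uv).
Qed.

Canonical pres_equiv := EquivRel pres_eqb
  pres_eqb_refl pres_eqb_sym pres_eqb_trans.

Definition pres_group := {eq_quot pres_equiv}.
HB.instance Definition _ := Choice.on pres_group.
HB.instance Definition _ := EqQuotient.on pres_group.

Lemma pres_piP u v : reflect (pres_eq u v) (\pi_pres_group u == \pi_pres_group v).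
Proof. by rewrite eqmodE; apply: asboolP. Qed.

Lemma pres_reprK u : pres_eq (repr (\pi_pres_group u)) u.
Proof. by apply/pres_piP; rewrite reprK. Qed.

Definition pres_one : pres_group := \pi_pres_group [::].

Definition pres_mul (g h : pres_group) : pres_group :=
  \pi_pres_group (repr g ++ repr h).

Definition pres_inv (g : pres_group) : pres_group :=
  \pi_pres_group (invw (repr g)).

Lemma pres_piM u v :
  pres_mul (\pi_pres_group u) (\pi_pres_group v) = \pi_pres_group (u ++ v).
Proof. by apply/eqP/pres_piP; apply: pres_cat; apply: pres_reprK. Qed.

Lemma pres_catwV u : pres_eq (u ++ invw u) [::].
Proof.
elim: u => [|[x b] u IHu] /=; first exact: pres_refl.
have -> : (x, b) :: u ++ invw ((x, b) :: u)
          = [:: (x, b)] ++ ((u ++ invw u) ++ [:: (x, ~~ b)]).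
  by rewrite /invw /= rev_cons -cats1 catA.
apply: pres_trans (pres_cancel x b).
apply: (pres_cat (pres_refl [:: (x, b)])).
exact: (pres_cat IHu (pres_refl [:: (x, ~~ b)])).
Qed.

Lemma invwK : involutive invw.
Proof.
move=> u; rewrite /invw map_rev revK -map_comp -[RHS]map_id.
by apply: eq_map => -[x b] /=; rewrite negbK.
Qed.

Lemma pres_mulA : associative pres_mul.
Proof.
move=> g h l; rewrite -[g]reprK -[h]reprK -[l]reprK.
set u := repr g; set v := repr h; set w := repr l.
by rewrite (pres_piM v) (pres_piM u) (pres_piM u) (pres_piM (u ++ v)) catA.
Qed.

Lemma pres_mul1 : left_id pres_one pres_mul.
Proof. by move=> g; rewrite -[g]reprK pres_piM. Qed.

Lemma pres_mulr1 : right_id pres_one pres_mul.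
Proof. by move=> g; rewrite -[g]reprK pres_piM cats0. Qed.

Lemma pres_mulV : left_inverse pres_one pres_inv pres_mul.
Proof.
move=> g; rewrite -{2}[g]reprK pres_piM; apply/eqP/pres_piP.
by rewrite -{2}[repr g]invwK; apply: pres_catwV.
Qed.

Lemma pres_mulrV : right_inverse pres_one pres_inv pres_mul.
Proof.
move=> g; rewrite -{1}[g]reprK pres_piM; apply/eqP/pres_piP.
exact: pres_catwV.
Qed.

HB.instance Definition _ := isGroup.Build pres_group
  pres_mulA pres_mul1 pres_mulr1 pres_mulV pres_mulrV.

Definition pres_gen (x : X) : pres_group := \pi_pres_group (letter x).

End Presentation.

Section MultiVirtualBraidGroup.
Variables n k : nat.

(* Indices start at 0: inl i is sigma_(i+1) and inr (a, i) is rho_(i+1)^a. *)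
Definition mvb_gen : choiceType := ('I_n.-1 + 'I_k * 'I_n.-1)%type.

Definition wsigma (i : 'I_n.-1) : word mvb_gen := letter (inl i : mvb_gen).
Definition wrho (a : 'I_k) (i : 'I_n.-1) : word mvb_gen :=
  letter (inr (a, i) : mvb_gen).

Definition far (i j : 'I_n.-1) : bool := (i.+2 <= j)%N || (j.+2 <= i)%N.

(* In the last two relations o is the superscript 0; 'I_k has no closed term
   for it since k is a variable. *)
Inductive mvb_rel : word mvb_gen -> word mvb_gen -> Prop :=
| mvb_sss (i j : 'I_n.-1) : j = i.+1 :> nat ->
    mvb_rel (wsigma i ++ wsigma j ++ wsigma i)
            (wsigma j ++ wsigma i ++ wsigma j)
| mvb_ss (i j : 'I_n.-1) : far i j ->
    mvb_rel (wsigma i ++ wsigma j) (wsigma j ++ wsigma i)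
| mvb_r2 (a : 'I_k) (i : 'I_n.-1) :
    mvb_rel (wrho a i ++ wrho a i) [::]
| mvb_rr (a : 'I_k) (i j : 'I_n.-1) : far i j ->
    mvb_rel (wrho a i ++ wrho a j) (wrho a j ++ wrho a i)
| mvb_rrr (a : 'I_k) (i j : 'I_n.-1) : j = i.+1 :> nat ->
    mvb_rel (wrho a i ++ wrho a j ++ wrho a i)
            (wrho a j ++ wrho a i ++ wrho a j)
| mvb_sr (a : 'I_k) (i j : 'I_n.-1) : far i j ->
    mvb_rel (wsigma i ++ wrho a j) (wrho a j ++ wsigma i)
| mvb_rr_mixed (a b : 'I_k) (i j : 'I_n.-1) : far i j -> a != b ->
    mvb_rel (wrho a i ++ wrho b j) (wrho b j ++ wrho a i)
| mvb_srr (o : 'I_k) (i j : 'I_n.-1) : o = 0%N :> nat -> j = i.+1 :> nat ->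
    mvb_rel (wsigma i ++ wrho o j ++ wrho o i)
            (wrho o j ++ wrho o i ++ wsigma j)
| mvb_rrr_mixed (o b : 'I_k) (i j : 'I_n.-1) :
    o = 0%N :> nat -> (1 <= b)%N -> j = i.+1 :> nat ->
    mvb_rel (wrho o i ++ wrho o j ++ wrho b i)
            (wrho b j ++ wrho o i ++ wrho o j).

Definition MVB : groupType := pres_group mvb_rel.

Definition sigma (i : 'I_n.-1) : MVB := pres_gen mvb_rel (inl i : mvb_gen).
Definition rho (a : 'I_k) (i : 'I_n.-1) : MVB :=
  pres_gen mvb_rel (inr (a, i) : mvb_gen).

End MultiVirtualBraidGroup.

Local Open Scope ring_scope.

(* The library's {'GL_n[R]} requires R to be finite. *)
Section GeneralLinearGroup.
Variables (F : comUnitRingType) (n : nat).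

Definition GL := {A : 'M[F]_n | A \in unitmx}.
HB.instance Definition _ := Choice.on GL.

Definition GLone : GL := exist _ 1%:M (unitmx1 F n).

Lemma GLmul_proof (A B : GL) : val A *m val B \in unitmx.
Proof. by rewrite unitmx_mul (valP A) (valP B). Qed.
Definition GLmul (A B : GL) : GL := exist _ (val A *m val B) (GLmul_proof A B).

Lemma GLinv_proof (A : GL) : invmx (val A) \in unitmx.
Proof. by rewrite unitmx_inv (valP A). Qed.
Definition GLinv (A : GL) : GL := exist _ (invmx (val A)) (GLinv_proof A).

Lemma GLmulA : associative GLmul.
Proof. by move=> A B C; apply/val_inj; rewrite /= mulmxA. Qed.
Lemma GLmul1 : left_id GLone GLmul.
Proof. by move=> A; apply/val_inj; rewrite /= mul1mx. Qed.
Lemma GLmulr1 : right_id GLone GLmul.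
Proof. by move=> A; apply/val_inj; rewrite /= mulmx1. Qed.
Lemma GLmulV : left_inverse GLone GLinv GLmul.
Proof. by move=> A; apply/val_inj; rewrite /= mulVmx ?(valP A). Qed.
Lemma GLmulrV : right_inverse GLone GLinv GLmul.
Proof. by move=> A; apply/val_inj; rewrite /= mulmxV ?(valP A). Qed.

HB.instance Definition _ := isGroup.Build GL
  GLmulA GLmul1 GLmulr1 GLmulV GLmulrV.

End GeneralLinearGroup.

Section LocalMatrices.
Variable F : fieldType.

Lemma Eblock_dim n (i : 'I_n.-1) : (i + (2 + (n - i.+2)) = n)%N.
Proof.
by rewrite addnA addn2 subnKC // -ltn_predRL ltn_ord.
Qed.

(* E_(i+1)(M) = diag(I_i, M, I_(n-i-2)), the index i starting at 0. *)
Definition Eblock n (i : 'I_n.-1) (M : 'M[F]_2) : 'M[F]_n :=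
  castmx (Eblock_dim i, Eblock_dim i)
    (block_mx (1%:M : 'M_i) 0 0 (block_mx M 0 0 (1%:M : 'M_(n - i.+2)))).

Definition mx2 (a b c d : F) : 'M[F]_2 :=
  \matrix_(p, q) if p == 0 then if q == 0 then a else b
                 else if q == 0 then c else d.

Variables n k : nat.

Definition rep_by (beta : MVB n k -> GL F n) (S : 'M[F]_2)
    (X : 'I_k -> 'M[F]_2) : Prop :=
  (forall i, val (beta (sigma k i)) = Eblock i S) /\
  (forall a i, val (beta (rho a i)) = Eblock i (X a)).

Definition homogeneous_2local (beta : MVB n k -> GL F n) : Prop :=
  exists S X, [/\ S \in unitmx, forall a, X a \in unitmx & rep_by beta S X].

Definition exceptional_S (S : 'M[F]_2) : Prop :=
  [\/ exists b c, b * c != 0 /\ S = mx2 (1 - b * c) b c 0,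
      exists b c, b * c != 0 /\ S = mx2 0 b c 0
    | exists c d, [/\ c != 0, d != 1 & S = mx2 0 (- ((d - 1) / c)) c d]].

Definition exceptional (beta : MVB n k -> GL F n) : Prop :=
  exists (S : 'M[F]_2) (x : 'I_k -> F),
    [/\ exceptional_S S, forall a, x a != 0
      & rep_by beta S (fun a => mx2 0 (x a) (x a)^-1 0)].

End LocalMatrices.

(* Main.v *)
Require Import Defs.
From mathcomp Require Import all_boot all_order all_algebra.
From mathcomp Require Import boolp complex reals.
From mathcomp Require Import ring zify.

Import GRing.Theory.
Local Open Scope quotient_scope.
Local Open Scope ring_scope.

(** Why it holds: the defining relations force so much on 2 x 2 blocks that a
    non-exceptional homogeneous 2-local representation kills a generator.

    Comparing entries of E_1(M) E_2(M) E_1(M) = E_2(M) E_1(M) E_2(M) gives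
    polynomial equations in the entries of M (braid_equations), and an
    invertible solution of these is the identity or lies in one of the three
    families of exceptional_S (braid_solutions). This applies to S, and to each X_a. Since
    X_a is moreover an involution, in the second case it is antidiagonal with
    entries x and 1/x (exceptional_invol). So a representation outside the
    listed types has S = 1 or some X_a = 1, that is, it sends some sigma_i or
    some rho_i^a to the identity matrix.

    It remains to see that the generators are not trivial in the abstract
    group. Every relation has the same number of letters sigma on both sides,
    and numbers of letters rho of the same parity, so counting the sigmas with
    sign gives a homomorphism to Z under which each sigma_i maps to 1, and
    counting the rhos gives a homomorphism to Z/2 under which each rho_i^a
    maps to 1 (sigma_neq1, rho_neq1). *)

(** * Additive invariants of group presentations *)

Section AdditiveInvariants.
Context {X : choiceType} {V : zmodType}.

Definition weight (f : X -> V) (u : word X) : V :=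
  \sum_(l <- u) (if l.2 then - f l.1 else f l.1).

Lemma weight_cat (f : X -> V) (u v : word X) :
  weight f (u ++ v) = weight f u + weight f v.
Proof. exact: big_cat. Qed.

Lemma weight_letter (f : X -> V) (x : X) : weight f (letter x) = f x.
Proof. exact: big_seq1. Qed.

(** A choice of weights in an abelian group that balances every relator extends
    to a homomorphism from the presented group, here stated on words. *)
Lemma pres_eq_weight (Rel : word X -> word X -> Prop) (f : X -> V) :
    (forall u v, Rel u v -> weight f u = weight f v) ->
  forall u v, pres_eq Rel u v -> weight f u = weight f v.
Proof.
move=> fP u v; elim=> {u v} [||u v w _ -> _ ->|u1 u2 v1 v2 _ Eu _ Ev|x b|] //.
- by rewrite !weight_cat Eu Ev.
- by rewrite /weight big_cons big_seq1 big_nil /=; case: b; rewrite ?subrr ?addNr.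
Qed.

Lemma pres_gen_neq1 (Rel : word X -> word X -> Prop) (f : X -> V) (x : X) :
    (forall u v, Rel u v -> weight f u = weight f v) ->
  f x != 0 -> pres_gen Rel x <> 1%g.
Proof.
move=> fP /eqP fx0 /eqP/pres_piP /(pres_eq_weight _ _ fP).
by rewrite weight_letter /weight big_nil.
Qed.

End AdditiveInvariants.

(** Detected by the exponent sum in the letters sigma. *)
Lemma sigma_neq1 (n k : nat) (i : 'I_n.-1) : sigma k i <> 1%g.
Proof.
pose f (g : mvb_gen n k) : int := if g is inl _ then 1 else 0.
apply: (pres_gen_neq1 _ f) => //.
by move=> _ _ [] *; rewrite !weight_cat !weight_letter /weight ?big_nil /=.
Qed.

(** Detected by the parity of the number of letters rho. *)
Lemma rho_neq1 (n k : nat) (a : 'I_k) (i : 'I_n.-1) : rho a i <> 1%g.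
Proof.
pose f (g : mvb_gen n k) : 'I_2 := if g is inr _ then 1 else 0.
apply: (pres_gen_neq1 _ f) => //.
by move=> _ _ [] *; rewrite !weight_cat !weight_letter /weight ?big_nil /=;
  apply/eqP.
Qed.

(** * Relations between the generators as equations in the group *)

Lemma pres_gen2 (X : choiceType) (Rel : word X -> word X -> Prop) (x y : X) :
  (pres_gen Rel x * pres_gen Rel y)%g = \pi_(pres_group Rel) (letter x ++ letter y).
Proof. exact: pres_piM. Qed.

Lemma pres_gen3 (X : choiceType) (Rel : word X -> word X -> Prop) (x y z : X) :
  (pres_gen Rel x * (pres_gen Rel y * pres_gen Rel z))%g
    = \pi_(pres_group Rel) (letter x ++ letter y ++ letter z).
Proof. by rewrite pres_gen2; apply: pres_piM. Qed.

Section MVBRelations.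
Context {n k : nat}.
Implicit Types (i j : 'I_n.-1) (a : 'I_k).

Lemma sigma_braid i j : j = i.+1 :> nat ->
  (sigma k i * (sigma k j * sigma k i) = sigma k j * (sigma k i * sigma k j))%g.
Proof.
by move=> ij; rewrite !pres_gen3; apply/eqP/pres_piP/pres_rel/mvb_sss.
Qed.

Lemma rho_braid a i j : j = i.+1 :> nat ->
  (rho a i * (rho a j * rho a i) = rho a j * (rho a i * rho a j))%g.
Proof.
by move=> ij; rewrite !pres_gen3; apply/eqP/pres_piP/pres_rel/mvb_rrr.
Qed.

Lemma rho_invol a i : (rho a i * rho a i = 1)%g.
Proof. by rewrite pres_gen2; apply/eqP/pres_piP/pres_rel/mvb_r2. Qed.

End MVBRelations.

(** * Local matrices satisfying the braid relation *)

Section LocalMatrixAlgebra.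
Context {F : fieldType}.

Lemma Eblock1 n (i : 'I_n.-1) : Eblock i (1%:M : 'M[F]_2) = 1%:M.
Proof.
rewrite /Eblock -!scalar_mx_block; move: (Eblock_dim i).
move: (nat_of_ord i) (n - i.+2)%N => r s E.
by case: n / E {i}; rewrite castmx_id.
Qed.

Lemma EblockM n (i : 'I_n.-1) (M N : 'M[F]_2) :
  Eblock i M *m Eblock i N = Eblock i (M *m N).
Proof.
rewrite /Eblock; move: (Eblock_dim i).
move: (nat_of_ord i) (n - i.+2)%N => r s E; case: n / E {i}; rewrite !castmx_id.
by rewrite !mulmx_block !(mul0mx, mulmx0, mulmx1, addr0, add0r).
Qed.

Lemma Eblock_inj n (i : 'I_n.-1) : injective (Eblock i : 'M[F]_2 -> 'M[F]_n).
Proof.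
move=> M N /(congr1 (castmx (esym (Eblock_dim i), esym (Eblock_dim i)))).
by rewrite !castmxK => /eq_block_mx[_ _ _] /eq_block_mx[].
Qed.

Lemma EblockE n (i : 'I_n.-1) (M : 'M[F]_2) (p q : 'I_n) :
  Eblock i M p q = if (i <= p < i.+2)%N && (i <= q < i.+2)%N
    then M (inord (p - i)) (inord (q - i)) else (p == q)%:R.
Proof.
rewrite castmxE -(inj_eq val_inj) /=.
set p' := cast_ord _ p; set q' := cast_ord _ q.
have Ep : p' = p :> nat by [].
have Eq : q' = q :> nat by [].
move: p' q' Ep Eq => p' q'.
case: (split_ordP p') => p1 -> /=; case: (split_ordP q') => q1 -> /= Ep Eq.
- rewrite block_mxEul mxE -Eq -Ep; case: ifP => //; have := ltn_ord p1; lia.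
- rewrite block_mxEur mxE -Eq -Ep; have := ltn_ord p1.
  case: ifP => [|_]; first lia.
  by move=> ?; rewrite (_ : (_ == _) = false) //; lia.
- rewrite block_mxEdl mxE -Eq -Ep; have := ltn_ord q1.
  case: ifP => [|_]; first lia.
  by move=> ?; rewrite (_ : (_ == _) = false) //; lia.
rewrite block_mxEdr -Eq -Ep {p q Eq Ep}.
case: (split_ordP p1) => p -> /=; case: (split_ordP q1) => q -> /=.
- rewrite block_mxEul !addKn !inord_val.
  by have := (ltn_ord p, ltn_ord q); case: ifP => // ? [? ?]; lia.
- rewrite block_mxEur mxE; have := ltn_ord p.
  case: ifP => [|_]; first lia.
  by move=> ?; rewrite (_ : (_ == _) = false) //; lia.
- rewrite block_mxEdl mxE; have := ltn_ord q.
  case: ifP => [|_]; first lia.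
  by move=> ?; rewrite (_ : (_ == _) = false) //; lia.
rewrite block_mxEdr mxE; case: ifP => [|_]; first lia.
by rewrite !eqn_add2l.
Qed.

(** When i <= 1 the first three rows of E_(i+1)(M) vanish beyond the third
    column, so in products of such matrices the leading 3 x 3 corner only
    depends on the leading 3 x 3 corners of the factors. This reduces the braid
    relation in every size n >= 3 to a computation with 3 x 3 matrices. *)
Lemma Eblock_mulE m (i : 'I_m.+2) (M : 'M[F]_2) (B : 'M[F]_m.+3) (p q : 'I_m.+3) :
    (i <= 1)%N -> (p <= 2)%N ->
  (Eblock (i : 'I_m.+3.-1) M *m B) p q =
    \sum_(r < 3) Eblock (i : 'I_m.+3.-1) M p (lshift m r) * B (lshift m r) q.
Proof.
move=> i1 p2; rewrite mxE (@big_split_ord _ _ _ 3 m) /= [X in _ + X]big1 ?addr0 //.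
move=> r _; rewrite EblockE /=; case: ifP => [|_]; first lia.
by rewrite -(inj_eq val_inj) (_ : (_ == _) = false) ?mul0r //=; lia.
Qed.

Lemma mx2E (M : 'M[F]_2) : M = mx2 (M 0 0) (M 0 1) (M 1 0) (M 1 1).
Proof.
apply/matrixP => p q; rewrite mxE.
by case: p q => -[|[|//]] ? [[|[|//]] ?] /=; congr (M _ _); apply: val_inj.
Qed.

(** These come from the entries (0,0), (2,2), (0,1) and (1,0) of the two sides of
    the braid relation. *)
Lemma braid_equations m (M : 'M[F]_2) (i j : 'I_m.+3.-1) :
    i = 0 :> nat -> j = 1 :> nat ->
    Eblock i M *m (Eblock j M *m Eblock i M)
      = Eblock j M *m (Eblock i M *m Eblock j M) ->
  let a := M 0 0 in let b := M 0 1 in let c := M 1 0 in let d := M 1 1 in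
  [/\ a * (a + b * c - 1) = 0, d * (d + b * c - 1) = 0,
      a * d * b = 0 & a * d * c = 0].
Proof.
move=> i0 j1 /matrixP braid a b c d.
have o0 : inord 0 = 0 :> 'I_2 by apply: val_inj; rewrite /= inordK.
have o1 : inord 1 = 1 :> 'I_2 by apply: val_inj; rewrite /= inordK.
have eq3 p q (hp : (p < 3)%N) (hq : (q < 3)%N) :=
  braid (lshift m (Ordinal hp)) (lshift m (Ordinal hq)).
have e00 := eq3 0%N 0%N isT isT.
have e01 := eq3 0%N 1%N isT isT.
have e10 := eq3 1%N 0%N isT isT.
have e22 := eq3 2%N 2%N isT isT.
move: e00 e01 e10 e22.
do ! rewrite Eblock_mulE ?i0 ?j1 // !big_ord_recl !big_ord0.
rewrite !EblockE i0 j1 /= ?o0 ?o1.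
rewrite -/a -/b -/c -/d.
move=> /eqP; rewrite -subr_eq0 => /eqP e00.
move=> /eqP; rewrite -subr_eq0 => /eqP e01.
move=> /eqP; rewrite -subr_eq0 => /eqP e10.
move=> /eqP; rewrite eq_sym -subr_eq0 => /eqP e22.
split; [rewrite -[RHS]e00 | rewrite -[RHS]e22 | rewrite -[RHS]e01
  | rewrite -[RHS]e10]; ring.
Qed.

Lemma det_mx2 (M : 'M[F]_2) : \det M = M 0 0 * M 1 1 - M 0 1 * M 1 0.
Proof.
rewrite (expand_det_row _ 0) big_ord_recl big_ord1 /cofactor !det_mx11 !mxE /=.
have l0 : lift 0 0 = 1 :> 'I_2 by apply: val_inj.
have l1 : lift 1 0 = 0 :> 'I_2 by apply: val_inj.
by rewrite !l0 l1 /bump /= expr0 expr1; ring.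
Qed.

Lemma mx2_1 : mx2 1 0 0 1 = 1%:M :> 'M[F]_2.
Proof. by rewrite [RHS]mx2E !mxE. Qed.

(** If a and d are both nonzero the equations force b = c = 0, hence
    a = d = 1. Otherwise a d = 0, so invertibility gives b c <> 0, and
    whichever of a, d is nonzero must equal 1 - b c; this yields the three
    families. *)
Lemma braid_solutions m (M : 'M[F]_2) (i j : 'I_m.+3.-1) :
    i = 0 :> nat -> j = 1 :> nat -> M \in unitmx ->
    Eblock i M *m (Eblock j M *m Eblock i M)
      = Eblock j M *m (Eblock i M *m Eblock j M) ->
  M = 1%:M \/ exceptional_S M.
Proof.
move=> i0 j1; rewrite unitmxE unitfE det_mx2 => detM /(braid_equations _ _ _ _ i0 j1).
rewrite -mx2_1 [M in M = _]mx2E [M in exceptional_S M]mx2E; move: detM.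
move: (M 0 0) (M 0 1) (M 1 0) (M 1 1) => a b c d /= detM [eqa eqd eqb eqc].
have [d0|dN0] := eqVneq d 0.
  move: detM; rewrite {}d0 mulr0 sub0r oppr_eq0 => bcN0; right.
  have [->|aN0] := eqVneq a 0; first by constructor 2; exists b, c.
  constructor 1; exists b, c; split => //.
  suff -> : a = 1 - b * c by [].
  apply/eqP; rewrite -subr_eq0; apply/eqP/(mulfI aN0).
  by rewrite mulr0 -[RHS]eqa; ring.
have [a0|aN0] := eqVneq a 0.
  move: detM; rewrite {}a0 mul0r sub0r oppr_eq0 mulf_eq0 => /norP[bN0 cN0].
  have bcd : b * c = 1 - d.
    apply/eqP; rewrite -subr_eq0; apply/eqP/(mulfI dN0).
    by rewrite mulr0 -[RHS]eqd; ring.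
  right; constructor 3; exists c, d; split=> //.
    by apply: contraNneq bN0 => d1; rewrite -(mulIr_eq0 _ (mulIf cN0)) bcd d1 subrr.
  by rewrite -mulNr opprB -bcd mulfK.
have adN0 : a * d != 0 by rewrite mulf_neq0.
left.
have /eqP b0 : b == 0 by move/eqP: eqb; rewrite mulf_eq0 (negPf adN0).
have /eqP c0 : c == 0 by move/eqP: eqc; rewrite mulf_eq0 (negPf adN0).
move: eqa eqd; rewrite b0 c0 mul0r !addr0.
move=> /eqP; rewrite mulf_eq0 (negPf aN0) subr_eq0 => /eqP ->.
by move=> /eqP; rewrite mulf_eq0 (negPf dN0) subr_eq0 => /eqP ->.
Qed.

(** Each family has a zero on the diagonal and a nonzero upper right entry b,
    while the entry (0,1) of the square is b times the trace: an involution
    therefore has zero diagonal. *)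
Lemma exceptional_invol (M : 'M[F]_2) :
  exceptional_S M -> M *m M = 1%:M -> M 0 1 != 0 /\ M = mx2 0 (M 0 1) (M 0 1)^-1 0.
Proof.
rewrite -mx2_1 => exM /matrixP MM.
have [a0d0 bN0] : ((M 0 0 == 0) || (M 1 1 == 0)) /\ M 0 1 != 0.
  case: exM => [[b [c [+ ->]]]|[b [c [+ ->]]]|[c [d [cN0 dN1 ->]]]];
    rewrite !mxE /= eqxx ?orbT.
  - by rewrite mulf_eq0 => /norP[].
  - by rewrite mulf_eq0 => /norP[].
  - by rewrite oppr_eq0 mulf_neq0 ?invr_eq0 ?subr_eq0.
split=> //; rewrite [LHS]mx2E.
move: (MM 0 0) (MM 0 1); rewrite !mxE !big_ord_recl !big_ord0 /= !addr0.
have l0 : lift 0 0 = 1 :> 'I_2 by apply: val_inj.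
rewrite !l0 => bc1 /eqP; move: (M 0 0) (M 0 1) (M 1 0) (M 1 1) a0d0 bN0 bc1.
move=> a b c d /= a0d0 bN0 bc1.
rewrite mulrC -mulrDr mulf_eq0 (negPf bN0) /= => ad0.
have [a0 d0] : a = 0 /\ d = 0.
  by case/orP: a0d0 ad0 => /eqP->; rewrite ?add0r ?addr0 => /eqP->.
move: bc1; rewrite a0 d0 mul0r add0r => bc1.
by rewrite -[c](mulKf bN0) bc1 mulr1.
Qed.

End LocalMatrixAlgebra.

(** * Homogeneous 2-local representations *)

Section TwoLocalRepresentations.
Context {F : fieldType} {m k : nat}.
Variables (beta : UMagmaMorphism.type (MVB m.+3 k) (GL F m.+3)).
Variables (S : 'M[F]_2) (X : 'I_k -> 'M[F]_2).
Hypothesis betaP : rep_by beta S X.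

Let i0 : 'I_m.+3.-1 := Ordinal (isT : 0 < m.+2)%N.
Let i1 : 'I_m.+3.-1 := Ordinal (isT : 1 < m.+2)%N.

Lemma rep_sigma_solutions : S \in unitmx -> S = 1%:M \/ exceptional_S S.
Proof.
move=> Su; apply: (@braid_solutions _ m _ i0 i1) => //.
have := congr1 (fun g => val (beta g)) (sigma_braid i0 i1 erefl).
by rewrite !gmulfM /= !betaP.1.
Qed.

Lemma rep_rho_solutions (a : 'I_k) : X a \in unitmx ->
  X a = 1%:M \/ (X a 0 1 != 0 /\ X a = mx2 0 (X a 0 1) (X a 0 1)^-1 0).
Proof.
move=> Xu; have [] // := @braid_solutions _ m (X a) i0 i1 erefl erefl Xu.
- have := congr1 (fun g => val (beta g)) (rho_braid a i0 i1 erefl).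
  by rewrite !gmulfM /= !betaP.2.
- by left.
move=> exX; right; apply: exceptional_invol exX _.
apply: (Eblock_inj _ i0); rewrite -EblockM Eblock1 -(betaP.2 a).
by have := congr1 (fun g => val (beta g)) (rho_invol a i0); rewrite gmulfM gmulf1.
Qed.

Lemma trivial_S_unfaithful : S = 1%:M -> ~ injective beta.
Proof.
move=> S1 inj; apply: (sigma_neq1 _ k i0).
apply/eqP; rewrite -(gmulf_eq1 _ inj); apply/eqP.
by apply: val_inj; rewrite betaP.1 S1 Eblock1.
Qed.

Lemma trivial_X_unfaithful (a : 'I_k) : X a = 1%:M -> ~ injective beta.
Proof.
move=> X1 inj; apply: (rho_neq1 _ _ a i0).
apply/eqP; rewrite -(gmulf_eq1 _ inj); apply/eqP.
by apply: val_inj; rewrite betaP.2 X1 Eblock1.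
Qed.

End TwoLocalRepresentations.

Theorem theorem3p3 (R : realType) (n k : nat) (hn : (3 <= n)%N) (hk : (1 < k)%N)
    (beta : UMagmaMorphism.type (MVB n k) (GL (complex R) n)) :
  homogeneous_2local beta -> ~ exceptional beta -> ~ injective beta.
Proof.
case: n hn beta => [|[|[|m]]] // _ beta [S [X [Su Xu betaP]]] nonexc.
have [/(trivial_S_unfaithful _ _ _ betaP) //|exS] := rep_sigma_solutions _ _ _ betaP Su.
have [[a X1]|XN1] := pselect (exists a, X a = 1%:M).
  exact: trivial_X_unfaithful betaP a X1.
have XP a : X a 0 1 != 0 /\ X a = mx2 0 (X a 0 1) (X a 0 1)^-1 0.
  have [X1|//] := rep_rho_solutions _ _ _ betaP a (Xu a).
  by case: XN1; exists a.
case: nonexc; exists S, (fun a => X a 0 1); split=> // [a|]; first by case: (XP a).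
by split=> [|a i]; [case: betaP | rewrite betaP.2 [in LHS](XP a).2].
Qed.
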